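(* Let $H$ be a hypergraph, let $U\subseteq V(H)$, and let $H_U$ be the sub-hypergraph of $H$ induced by $U$. If a vector $y:U\to\mathbb{C}$ belongs to the null space of $B_{H_U}$, then its extension $y':V(H)\to\mathbb{C}$, given by $y'(i)=y(i)$ for $i\in U$ and $y'(i)=0$ for $i\in V(H)\setminus U$, belongs to the null space of $B_H$.
   Context: A hypergraph $H$ is a pair $(V(H),E(H))$ with $V(H)$ a non-empty finite set (vertices) and $E(H)$ a set of non-empty subsets of $V(H)$ (hyperedges). The edge-vertex incidence matrix $B_H=[b_{ev}]_{e\in E(H),v\in V(H)}$ has $b_{ev}=1$ if $v\in e$ and $b_{ev}=0$ otherwise; for a vector $x:V(H)\to\mathbb{C}$, $(B_Hx)(e)=\sum_{v\in e}x(v)$. For (non-empty) $U\subseteq V(H)$, the sub-hypergraph $H_U$ of $H$ induced by $U$ has $V(H_U)=U$ and $E(H_U)=\{e\cap U: e\in E(H),\ e\cap U\neq\emptyset\}$ (a set, without repetitions). *)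

(* Defs.v *)
From mathcomp Require Import all_boot all_order all_algebra.

Set Implicit Arguments.
Unset Strict Implicit.
Unset Printing Implicit Defensive.

Import GRing.Theory.
Local Open Scope ring_scope.

Record hypergraph := Hypergraph {
  vertex : finType;
  edges : {set {set vertex}};
  vertex_gt0 : (0 < #|vertex|)%N;
  edges_neq0 : set0 \notin edges
}.

(* Rows and columns are numbered by the enumerations of [edges H] and
   [vertex H]. *)
Definition incidence_mx (K : pzSemiRingType) (H : hypergraph) :
    'M[K]_(#|edges H|, #|vertex H|) :=
  \matrix_(e, v) ((enum_val v \in (enum_val e : {set vertex H}))%:R : K).

Definition col_of_fun (K : Type) (V : finType) (x : V -> K) : 'cV[K]_#|V| :=
  \col_i x (enum_val i).

(* MathComp's [kermx] is the left kernel, acting on row vectors; here the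
   matrix acts on column vectors. *)
Definition null_space (K : pzSemiRingType) (m n : nat) (A : 'M[K]_(m, n)) :
    {pred 'cV[K]_n} :=
  [pred x | A *m x == 0].

Section Induced.
Variables (H : hypergraph) (U : {set vertex H}).

Definition induced_vertex : finType := {x : vertex H | x \in U}.

(* The intersection of e and U, viewed as a set of elements of the subtype U. *)
Definition trace (e : {set vertex H}) : {set induced_vertex} :=
  [set u | val u \in e].

Definition induced_edges : {set {set induced_vertex}} :=
  [set trace e | e in edges H & e :&: U != set0].

Lemma induced_vertex_gt0 : U != set0 -> (0 < #|induced_vertex|)%N.
Proof. by rewrite card_sig card_gt0. Qed.

Lemma induced_edges_neq0 : set0 \notin induced_edges.
Proof.
apply/imsetP => -[e /setIdP[_ /set0Pn[x /setIP[xe xU]]]] /setP/(_ (Sub x xU)).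
by rewrite !inE SubK xe.
Qed.

Definition induced (hU : U != set0) : hypergraph :=
  Hypergraph (induced_vertex_gt0 hU) induced_edges_neq0.

Definition extend0 (K : nmodType) (y : induced_vertex -> K) (i : vertex H) : K :=
  if insub i is Some u then y u else 0.

End Induced.

(* Main.v *)
Require Import Defs.
From mathcomp Require Import all_boot all_order all_algebra.
From mathcomp Require Import reals complex.

Set Implicit Arguments.
Unset Strict Implicit.
Unset Printing Implicit Defensive.

Local Open Scope ring_scope.

(** A vector lies in the null space of the incidence matrix exactly when its
    entries sum to zero over every hyperedge ([incidence_null_spaceP]).
    Extending [y] by zero turns the sum over a hyperedge [e] into the sum of [y]
    over the part of [e] inside [U] ([sum_extend0]).  Either that part is empty,
    and the sum vanishes trivially, or it is a hyperedge of the induced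
    sub-hypergraph, and the sum vanishes by hypothesis.  Distinct hyperedges
    with the same trace impose the same condition, so it is harmless that the
    induced hyperedges form a set without repetitions. *)

(** This removes the numbering of rows and columns, so that the rest of the
    argument only speaks of hyperedges and vertices. *)
Lemma incidence_null_spaceP (K : pzSemiRingType) (H : hypergraph)
    (x : vertex H -> K) :
  reflect {in edges H, forall e : {set vertex H}, \sum_(v in e) x v = 0}
          (col_of_fun x \in null_space (incidence_mx K H)).
Proof.
have rowE (i : 'I_#|edges H|) :
    (incidence_mx K H *m col_of_fun x) i 0
    = \sum_(v in (enum_val i : {set vertex H})) x v.
  rewrite mxE [RHS]big_mkcond [RHS](reindex _ (onW_bij _ (@enum_val_bij _))) /=.
  apply: eq_bigr => j _; rewrite !mxE.
  by case: ifP; rewrite ?GRing.mul1r ?GRing.mul0r.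
rewrite inE; apply: (iffP eqP) => [Bx0 e eH | x0].
  by rewrite -(enum_rankK_in eH eH) -rowE Bx0 mxE.
by apply/colP => i; rewrite rowE mxE x0 ?enum_valP.
Qed.

Lemma sum_extend0 (H : hypergraph) (U : {set vertex H}) (K : nmodType)
    (y : induced_vertex U -> K) (e : {set vertex H}) :
  \sum_(v in e) extend0 y v = \sum_(u in trace U e) y u.
Proof.
rewrite (bigID (mem U)) /= [X in _ + X]big1 ?GRing.addr0; last first.
  by move=> v /andP[_ vU]; rewrite /extend0 insubN.
rewrite (reindex_omap (val : induced_vertex U -> vertex H) insub) /=; last first.
  by move=> v /andP[_ vU]; rewrite insubT.
apply: eq_big => [u | u _]; last by rewrite /extend0 valK.
by rewrite inE valK eqxx andbT (valP u) andbT.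
Qed.

Theorem theorem2p11 (R : realType) (H : hypergraph) (U : {set vertex H})
    (hU : U != set0) (y : induced_vertex U -> R[i]) :
  col_of_fun y \in null_space (incidence_mx R[i] (induced hU)) ->
  col_of_fun (extend0 y) \in null_space (incidence_mx R[i] H).
Proof.
move/(@incidence_null_spaceP _ (induced hU)) => y0.
apply/incidence_null_spaceP => e eH; rewrite sum_extend0.
have [eU0 | eU] := eqVneq (e :&: U) set0.
  rewrite big1 // => u; rewrite inE => ue.
  by have := in_set0 (val u); rewrite -eU0 inE ue (valP u).
by apply: y0; apply/imsetP; exists e; rewrite // inE eH.
Qed.
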